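(* Let $K\in\mathbb{R}^{N\times N}$ be a kernel matrix (as specified in the context). Fix $r'\in\mathbb{N}$ and $\epsilon>0$, suppose $\operatorname{tr}(K-[K]_{r'})>0$, and set $$\zeta=(1+\epsilon)\operatorname{tr}(K-[K]_{r'}),\qquad \eta=\operatorname{tr}(K-[K]_{r'})/\operatorname{tr}K.$$ Let $\tilde K$ be the (random) rank-$r$ partial Cholesky approximation of $K$ produced by the randomly pivoted Cholesky algorithm using $r$ columns of $K$, where $r'\leq r<N$ and $r\geq\frac{r'}{\epsilon}+r'\log\frac{1}{\epsilon\eta}$. Let $t\in\mathbb{R}$ and the rank parameter $r$ be chosen such that moreover $$1<t<\frac{d_{\min}}{\sqrt{N}\zeta}.$$ Then with probability at least $1-1/t$ (over the random choice of sampled columns) one has $\tilde d_{\min}>d_{\min}-\sqrt{N}t\zeta>0$ (so that $\tilde L$ is well defined) and $$\lVert L-\tilde L\rVert_*<\Bigl[\frac{1}{d_{\min}}+\frac{\sqrt{N}\operatorname{tr}(K)}{(d_{\min}-\sqrt{N}t\zeta)^2}+\frac{N\operatorname{tr}(K)\,t\zeta}{4(d_{\min}-\sqrt{N}t\zeta)^3}\Bigr]t\zeta,$$ where $L=D^{-1/2}KD^{-1/2}$ and $\tilde L=\tilde D^{-1/2}\tilde K\tilde D^{-1/2}$.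
   Context: Setting. Let $k\colon\mathbb{R}^d\times\mathbb{R}^d\to\mathbb{R}$ be a kernel function that is continuous, bounded and positive semidefinite (symmetric, with positive semidefinite kernel matrices), with $k(u,v)>0$ for all $u,v\in\mathbb{R}^d$. Given samples $u_0,\ldots,u_{N-1}\in\mathbb{R}^d$, $N\in\mathbb{N}$, the kernel matrix is $K\in\mathbb{R}^{N\times N}$ with entries $K_{ij}=k(u_i,u_j)$. Notation. $1_N\in\mathbb{R}^N$ is the vector of ones. $D=\operatorname{diag}(K1_N)$ and $\tilde D=\operatorname{diag}(\tilde K1_N)$ are diagonal matrices with diagonal entries $d_i=(K1_N)_i>0$ and $\tilde d_i=(\tilde K1_N)_i$; $d_{\min}=\min_{0\leq i<N}d_i$, $\tilde d_{\min}=\min_{0\leq i<N}\tilde d_i$. $\lVert\cdot\rVert_*$ is the trace (nuclear) norm. $[K]_{r'}$ is an optimal rank-$r'$ approximation of $K$, obtained from its eigenvalue decomposition by setting the trailing $N-r'$ eigenvalues (in descending order) to zero; thus $\operatorname{tr}(K-[K]_{r'})$ is the sum of the $N-r'$ smallest eigenvalues of $K$. Randomly pivoted Cholesky. Pivots (column indices) $s_0,\ldots,s_{r-1}\in\{0,\ldots,N-1\}$ are drawn sequentially. For a set $S$ of indices, the column Nyström approximation is $K(:,S)K(S,S)^+K(:,S)^\top$, where $^+$ is the Moore–Penrose pseudoinverse. Put $\tilde K^{(0)}=0$ and let $\tilde K^{(i)}$ be the column Nyström approximation for $S=\{s_0,\ldots,s_{i-1}\}$. With $\rho^{(i)}=\operatorname{diag}(K-\tilde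 K^{(i)})$, the pivot $s_i$ is drawn, conditionally on the previous pivots, with probability $\mathbb{P}\{s_i=j\}=\rho^{(i)}(j)/\sum_{l=0}^{N-1}\rho^{(i)}(l)$ (if $\rho^{(i)}=0$ the algorithm stops with $\tilde K=K$). The output is $\tilde K=\tilde K^{(r)}$, which can be written $\tilde K=FF^\top$ with $F\in\mathbb{R}^{N\times r}$, and satisfies $K\geq\tilde K\geq 0$ in the positive semidefinite order. Known result that may be used (Chen et al., cited by the paper): for a positive semidefinite matrix $K$ and $r,r',\epsilon,\zeta,\eta$ with $r\geq r'$ and $r\geq\frac{r'}{\epsilon}+r'\log\frac{1}{\epsilon\eta}$, the output of randomly pivoted Cholesky satisfies $\mathbb{E}\operatorname{tr}(K-\tilde K)\leq\zeta$. *)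

(* Defs.v *)
From HB Require Import structures.
From mathcomp Require Import all_boot all_order all_algebra.
From mathcomp Require Import all_classical all_reals all_analysis.
Set Implicit Arguments.
Unset Strict Implicit.
Unset Printing Implicit Defensive.
Import Order.TTheory GRing.Theory Num.Theory numFieldNormedType.Exports.
Local Open Scope classical_set_scope.
Local Open Scope ring_scope.

Definition psdmx (R : realType) (n : nat) (A : 'M[R]_n) : Prop :=
  A^T = A /\ forall x : 'cV[R]_n, 0 <= (x^T *m A *m x) 0 0.

Definition kernel_mx (R : realType) (d n : nat)
    (k : 'rV[R]_d -> 'rV[R]_d -> R) (u : 'I_n -> 'rV[R]_d) : 'M[R]_n :=
  \matrix_(i, j) k (u i) (u j).

Definition psd_kernel (R : realType) (d : nat)
    (k : 'rV[R]_d -> 'rV[R]_d -> R) : Prop :=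
  (forall u v, k u v = k v u) /\
  forall (n : nat) (u : 'I_n -> 'rV[R]_d), psdmx (kernel_mx k u).

Definition kernel_bounded (R : realType) (d : nat)
    (k : 'rV[R]_d -> 'rV[R]_d -> R) : Prop :=
  exists M : R, forall u v, `|k u v| <= M.

Definition kernel_continuous (R : realType) (d : nat)
    (k : 'rV[R]_d -> 'rV[R]_d -> R) : Prop :=
  continuous (fun p : 'rV[R]_d * 'rV[R]_d => k p.1 p.2).

(* The columns of p.1 are orthonormal eigenvectors and p.2 lists the
   eigenvalues in descending order, with multiplicity. *)
Definition is_eigendec (R : realType) (n : nat) (A : 'M[R]_n)
    (p : 'M[R]_n * 'rV[R]_n) : Prop :=
  [/\ p.1^T *m p.1 = 1%:M,
      forall i j : 'I_n, (i <= j)%N -> p.2 0 j <= p.2 0 i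
    & A = p.1 *m diag_mx p.2 *m p.1^T].

(* An eigenvalue decomposition exists for every symmetric A, and only
   symmetric matrices are decomposed below; the default value (0, 0) is then
   never reached.  The eigenvalues are unique, the eigenvectors are not. *)
Definition eigendec (R : realType) (n : nat) (A : 'M[R]_n) :
    'M[R]_n * 'rV[R]_n :=
  xget (0, 0) [set p | is_eigendec A p].

Definition eigvec (R : realType) (n : nat) (A : 'M[R]_n) : 'M[R]_n :=
  (eigendec A).1.

Definition eigval (R : realType) (n : nat) (A : 'M[R]_n) : 'rV[R]_n :=
  (eigendec A).2.

Definition lowrank (R : realType) (n : nat) (A : 'M[R]_n) (r : nat) :
    'M[R]_n :=
  eigvec A *m diag_mx (\row_(i < n) if (i < r)%N then eigval A 0 i else 0)
    *m (eigvec A)^T.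

(* Sum of the singular values, i.e. of the square roots of the eigenvalues
   of A^T A. *)
Definition trace_norm (R : realType) (n : nat) (A : 'M[R]_n) : R :=
  \sum_(i < n) Num.sqrt (eigval (A^T *m A) 0 i).

Definition is_mpinv (R : realType) (m n : nat) (A : 'M[R]_(m, n))
    (X : 'M[R]_(n, m)) : Prop :=
  [/\ A *m X *m A = A, X *m A *m X = X,
      (A *m X)^T = A *m X & (X *m A)^T = X *m A].

(* The Moore-Penrose pseudoinverse: the four Penrose equations have exactly
   one solution.  (The library's pinvmx is only a generalized inverse.) *)
Definition mpinv (R : realType) (m n : nat) (A : 'M[R]_(m, n)) :
    'M[R]_(n, m) :=
  xget 0 [set X | is_mpinv A X].

Definition nystrom (R : realType) (n : nat) (K : 'M[R]_n) (S : {set 'I_n}) :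
    'M[R]_n :=
  let f : 'I_#|S| -> 'I_n := enum_val in
  colsub f K *m mpinv (mxsub f f K) *m (colsub f K)^T.

(* A run of randomly pivoted Cholesky is recorded as a sequence over
   option 'I_n: Some j means that pivot j was drawn, None that the algorithm
   had stopped and no pivot was drawn. *)
Definition pivot_set (n : nat) (p : seq (option 'I_n)) : {set 'I_n} :=
  [set j | Some j \in p]%SET.

Definition rpc_approx (R : realType) (n : nat) (K : 'M[R]_n)
    (p : seq (option 'I_n)) : 'M[R]_n :=
  nystrom K (pivot_set p).

Definition rpc_residual (R : realType) (n : nat) (K : 'M[R]_n)
    (p : seq (option 'I_n)) (j : 'I_n) : R :=
  (K - rpc_approx K p) j j.

(* Conditional distribution of the next draw given the past draws p; when the
   residual diagonal vanishes, Some j gets mass 0 / 0 = 0 and None mass 1. *)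
Definition rpc_step (R : realType) (n : nat) (K : 'M[R]_n)
    (p : seq (option 'I_n)) (x : option 'I_n) : R :=
  match x with
  | Some j => rpc_residual K p j / \sum_(l < n) rpc_residual K p l
  | None => if [forall l, rpc_residual K p l == 0] then 1 else 0
  end.

Definition draws (T : Type) (n : nat) (s : nat -> T -> option 'I_n) (i : nat)
    (w : T) : seq (option 'I_n) :=
  mkseq (fun l => s l w) i.

(* s 0, ..., s (r - 1) are random variables on (T, P) distributed as r steps of
   randomly pivoted Cholesky.  The conditional law is expressed in product
   form, P (A /\ B) = P A * P (B | A), so that pasts of probability zero need
   no separate treatment. *)
Definition rpc_run (R : realType) (disp : measure_display)
    (T : measurableType disp) (P : probability T R) (n : nat) (K : 'M[R]_n)
    (r : nat) (s : nat -> T -> option 'I_n) : Prop :=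
  (forall (i : nat) (x : option 'I_n), (i < r)%N ->
     measurable [set w | s i w = x]) /\
  (forall (i : nat) (p : seq (option 'I_n)) (x : option 'I_n), (i < r)%N ->
     P [set w | draws s i w = p /\ s i w = x] =
     (P [set w | draws s i w = p] * (rpc_step K p x)%:E)%E).

Definition degree (R : realType) (n : nat) (A : 'M[R]_n) : 'cV[R]_n :=
  A *m const_mx 1.

(* The minimum entry; the value for n = 0 is a dummy. *)
Definition vmin (R : realType) (n : nat) : 'cV[R]_n -> R :=
  match n with
  | 0 => fun _ => 0
  | n'.+1 => fun v => \big[Num.min/v ord0 0]_(i < n'.+1) v i 0
  end.

Definition dmin (R : realType) (n : nat) (A : 'M[R]_n) : R :=
  vmin (degree A).

(* D^(-1/2) A D^(-1/2) with D = diag (A 1). *)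
Definition normalize (R : realType) (n : nat) (A : 'M[R]_n) : 'M[R]_n :=
  let Dinvsqrt := diag_mx (\row_(i < n) (Num.sqrt (degree A i 0))^-1) in
  Dinvsqrt *m A *m Dinvsqrt.

(* Main.v *)
Require Import Defs.
From HB Require Import structures.
From mathcomp Require Import all_boot all_order all_algebra.
From mathcomp Require Import all_classical all_reals all_analysis.
From mathcomp Require Import ring lra.
Set Implicit Arguments.
Unset Strict Implicit.
Unset Printing Implicit Defensive.
Import Order.TTheory GRing.Theory Num.Theory numFieldNormedType.Exports.
Local Open Scope classical_set_scope.
Local Open Scope ring_scope.

(* Let P be the orthogonal projection onto the r' leading eigenvectors of K and
   b = tr ((1 - P) K) the tail.  One pivot turns the residual X into a residual
   of mean X - X^2 / tr X, and tr ((1 - P) X) <= b throughout since X <= K.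
   With tr (X P X) >= tr (P X)^2 / r' and Jensen's inequality for the convex
   function x^2 / (x + b), the means a_i = E tr (P X_i) satisfy
   a_(i+1) <= a_i - a_i^2 / (r' (a_i + b)).  The potential
   r' ln a - r' b / a then drops by at least 1 at each step, which forces
   a_r <= eps b, i.e. E tr (K - Kt) <= zeta.  Markov's inequality reduces the
   claim to the event tr (K - Kt) < t zeta, where the bound is deterministic:
   with E = Dt^(-1/2) - D^(-1/2),
     L - Lt = D^(-1/2) (K - Kt) D^(-1/2) - E Kt D^(-1/2) - D^(-1/2) Kt E - E Kt E,
   |E| <= sqrt N t zeta / (2 delta^(3/2)) entrywise, and the trace norm of
   X B Y, for diagonal X, Y and B psd, is at most max |X| max |Y| tr B. *)

(** * Positive semidefinite matrices and the trace norm *)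

Section PositiveSemidefinite.
Variable R : realType.

Lemma psdmx_conj (n m : nat) (B : 'M[R]_n) (A : 'M[R]_(n, m)) :
  psdmx B -> psdmx (A^T *m B *m A).
Proof.
case=> symB posB; split; first by rewrite !trmx_mul trmxK symB mulmxA.
by move=> x; have := posB (A *m x); rewrite trmx_mul !mulmxA.
Qed.

Lemma psdmx_diag_ge0 (n : nat) (B : 'M[R]_n) (i : 'I_n) : psdmx B -> 0 <= B i i.
Proof.
case=> _ /(_ (delta_mx i 0)).
by rewrite trmx_delta -rowE -colE !mxE.
Qed.

Lemma psdmx_tr_ge0 (n : nat) (B : 'M[R]_n) : psdmx B -> 0 <= \tr B.
Proof. by move=> psdB; apply: sumr_ge0 => i _; exact: psdmx_diag_ge0. Qed.

(** Expand the nonnegative trace of the form [B] at [X - c *: Z]. The free weight [c] lets this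
    stand in for Cauchy-Schwarz without square roots. *)
Lemma psdmx_amgm (n m : nat) (B : 'M[R]_n) (X Z : 'M[R]_(n, m)) (c : R) :
  psdmx B ->
  2 * c * \tr (X^T *m B *m Z) <=
    \tr (X^T *m B *m X) + c ^+ 2 * \tr (Z^T *m B *m Z).
Proof.
move=> psdB; have := psdmx_tr_ge0 (psdmx_conj (X - c *: Z) psdB).
have ZX : \tr (Z^T *m B *m X) = \tr (X^T *m B *m Z).
  by rewrite -mxtrace_tr !trmx_mul trmxK (proj1 psdB) mulmxA.
have -> : (X - c *: Z)^T = X^T - c *: Z^T by rewrite linearB linearZ.
rewrite !(mulmxBl, mulmxBr) -!(scalemxAl, scalemxAr).
rewrite scalerA !(linearB, mxtraceZ) /= !(linearB, mxtraceZ) /= ZX => h.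
by rewrite -subr_ge0; congr (_ <= _): h; ring.
Qed.

Lemma gram_tr_ge0 (n m : nat) (A : 'M[R]_(n, m)) : 0 <= \tr (A^T *m A).
Proof.
apply: sumr_ge0 => j _; rewrite mxE; apply: sumr_ge0 => i _.
by rewrite mxE -expr2 sqr_ge0.
Qed.

Lemma gram_tr_eq0 (n m : nat) (A : 'M[R]_(n, m)) : \tr (A^T *m A) = 0 -> A = 0.
Proof.
have ge0 (j : 'I_m) (i : 'I_n) : 0 <= A^T j i * A i j.
  by rewrite mxE -expr2 sqr_ge0.
move=> tr0; apply/matrixP => i j; rewrite mxE.
have : (A^T *m A) j j = 0.
  by apply: (psumr_eq0P _ tr0) => // l _; rewrite mxE sumr_ge0.
rewrite mxE => /psumr_eq0P -/(_ (fun i _ => ge0 j i) i isT).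
by rewrite mxE -expr2 => /eqP; rewrite sqrf_eq0 => /eqP.
Qed.

(* AM-GM against Z = B X with weight c = |B X|^2 / (q + 1). *)
Lemma psdmx_null (n m : nat) (B : 'M[R]_n) (X : 'M[R]_(n, m)) :
  psdmx B -> X^T *m B *m X = 0 -> B *m X = 0.
Proof.
move=> psdB X0; apply: gram_tr_eq0.
set b := \tr _; have b_ge0 : 0 <= b by exact: gram_tr_ge0.
set q := \tr ((B *m X)^T *m B *m (B *m X)).
have q_ge0 : 0 <= q by apply/psdmx_tr_ge0/psdmx_conj.
have := psdmx_amgm X (B *m X) (b / (q + 1)) psdB.
rewrite X0 linear0 add0r -/q.
have -> : \tr (X^T *m B *m (B *m X)) = b.
  by rewrite /b trmx_mul (proj1 psdB) !mulmxA.
have q1 : 0 < q + 1 by rewrite ltr_wpDl.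
have : b / (q + 1) * (q + 1) = b by rewrite divfK // gt_eqF.
move: (b / (q + 1)) => c cq h.
have c_ge0 : 0 <= c by rewrite -(pmulr_lge0 _ q1) cq.
(* Since [b = c * (q + 1)], [h] reads [2 c^2 (q + 1) <= c^2 q], which forces [c = 0]; the added 1
   keeps the weight meaningful when [q = 0]. *)
nra.
Qed.

Lemma idem_gram (n : nat) (P : 'M[R]_n) : P^T = P -> P *m P = P -> P^T *m P = P.
Proof. by move=> -> ->. Qed.

Lemma projC_idem (n : nat) (P : 'M[R]_n) :
  P^T = P -> P *m P = P ->
  (1%:M - P)^T = 1%:M - P /\ (1%:M - P) *m (1%:M - P) = 1%:M - P.
Proof.
move=> sP iP; split; first by rewrite linearB /= trmx1 sP.
by rewrite mulmxBl !mulmxBr !mul1mx mulmx1 iP subrr subr0.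
Qed.

Lemma tr_proj_mul (n : nat) (P B : 'M[R]_n) :
  P^T = P -> P *m P = P -> \tr (P *m B) = \tr (P^T *m B *m P).
Proof. by move=> sP iP; rewrite sP -{1}iP -mulmxA mxtrace_mulC. Qed.

Lemma tr_proj_mul_ge0 (n : nat) (P B : 'M[R]_n) :
  P^T = P -> P *m P = P -> psdmx B -> 0 <= \tr (P *m B).
Proof.
by move=> sP iP psdB; rewrite tr_proj_mul //; apply/psdmx_tr_ge0/psdmx_conj.
Qed.

Lemma tr_proj_mul_le (n : nat) (P B : 'M[R]_n) :
  P^T = P -> P *m P = P -> psdmx B -> \tr (P *m B) <= \tr B.
Proof.
move=> sP iP psdB; have [sQ iQ] := projC_idem sP iP.
have := tr_proj_mul_ge0 sQ iQ psdB.
by rewrite mulmxBl mul1mx linearB /= subr_ge0.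
Qed.

(* The partial isometry comes from a singular value decomposition.  Without an
   eigendecomposition of M^T M the trace norm takes its default value 0, and
   W = 0 serves; existence of eigendecompositions is therefore not needed. *)
Lemma trace_norm_dual (n : nat) (M : 'M[R]_n) :
  exists W : 'M[R]_n,
    (W^T *m W) *m (W^T *m W) = W^T *m W /\ trace_norm M = \tr (W *m M).
Proof.
rewrite /trace_norm /eigval /eigendec.
case: xgetP => [[V s] _ /=|none].
  case=> /= VV _ MM.
  have ge0 i : 0 <= s 0 i.
    have -> : s 0 i = ((M *m V)^T *m (M *m V)) i i.
      rewrite trmx_mul mulmxA -[V^T *m _ *m M]mulmxA MM !mulmxA VV mul1mx.
      by rewrite -mulmxA VV mulmx1 mxE eqxx.
    by rewrite mxE sumr_ge0 // => l _; rewrite mxE -expr2 sqr_ge0.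
  (* As [0^-1 = 0], [h] inverts the nonzero singular values and annihilates the others, so [U] is a
     partial isometry even for singular [M]. *)
  pose h := \row_i (Num.sqrt (s 0 i))^-1.
  pose U := M *m V *m diag_mx h.
  have VMMV : V^T *m M^T *m M *m V = diag_mx s.
    by rewrite -[V^T *m _ *m M]mulmxA MM !mulmxA VV mul1mx -mulmxA VV mulmx1.
  have hs i : h 0 i * s 0 i = Num.sqrt (s 0 i).
    rewrite mxE -{2}(sqr_sqrtr (ge0 i)); have [->|nz] := eqVneq (Num.sqrt (s 0 i)) 0.
      by rewrite invr0 mul0r.
    by rewrite expr2 mulKf.
  have UU : U *m (U^T *m U) = U.
    rewrite /U !trmx_mul !mulmxA -!mulmxA; congr (M *m (V *m _)).
    rewrite !mulmxA -[_ *m V^T *m _]mulmxA -[_ *m _ *m M]mulmxA.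
    rewrite -[diag_mx h *m (diag_mx h)^T *m _ *m _]mulmxA VMMV tr_diag_mx.
    rewrite !mulmx_diag; congr diag_mx; apply/rowP => i.
    rewrite !mxE -[_ * _ * s 0 i]mulrA.
    have := hs i; rewrite mxE => ->.
    have [->|nz] := eqVneq (Num.sqrt (s 0 i)) 0; first by rewrite invr0 !mul0r.
    by rewrite mulVf // mul1r.
  exists (V *m U^T); split.
    rewrite trmx_mul trmxK.
    have -> : U *m V^T *m (V *m U^T) = U *m U^T.
      by rewrite mulmxA -[U *m _ *m V]mulmxA VV mulmx1.
    by rewrite mulmxA -[U *m _ *m U]mulmxA UU.
  rewrite -mulmxA mxtrace_mulC /U !trmx_mul tr_diag_mx -!mulmxA.
  rewrite [_ *m (M *m V)]mulmxA [_ *m (_ *m _ *m V)]mulmxA mulmxA VMMV.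
  rewrite mulmx_diag mxtrace_diag; apply: eq_bigr => i _.
  by rewrite mxE hs.
exists 0; rewrite trmx0 !mul0mx mxtrace0 big1 //.
by move=> i _; rewrite mxE sqrtr0.
Qed.

Lemma tr_conj_diag_le (n : nat) (B : 'M[R]_n) (x : 'rV[R]_n) (e : R) :
  psdmx B -> (forall i, `|x 0 i| <= e) ->
  \tr (diag_mx x *m B *m diag_mx x) <= e ^+ 2 * \tr B.
Proof.
move=> psdB xe; rewrite /mxtrace big_distrr /=; apply: ler_sum => i _.
rewrite mul_mx_diag mxE mul_diag_mx mxE mulrAC ler_wpM2r ?psdmx_diag_ge0 //.
by rewrite -expr2 -real_normK ?num_real // lerXn2r ?nnegrE // (le_trans _ (xe i)).
Qed.

(** AM-GM at [diag_mx x *m W^T] and [diag_mx y] leaves two diagonal congruences of [B]; the weight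
    [e / f] makes their bounds equal. *)
Lemma tr_isometry_diag_le (n : nat) (B W : 'M[R]_n) (x y : 'rV[R]_n) (e f : R) :
  psdmx B -> (W^T *m W) *m (W^T *m W) = W^T *m W ->
  0 < e -> 0 < f ->
  (forall i, `|x 0 i| <= e) -> (forall i, `|y 0 i| <= f) ->
  \tr (W *m (diag_mx x *m B *m diag_mx y)) <= e * f * \tr B.
Proof.
move=> psdB WW e_gt0 f_gt0 xe yf.
have := psdmx_amgm (diag_mx x *m W^T) (diag_mx y) (e / f) psdB.
rewrite trmx_mul trmxK !tr_diag_mx !mulmxA => h.
have sWW : (W^T *m W)^T = W^T *m W by rewrite trmx_mul trmxK.
(* Cyclicity collects [W] into the projection [W^T *m W], which can only lower the trace of a psd
   matrix. *)
have : \tr (W *m diag_mx x *m B *m diag_mx x *m W^T) <= e ^+ 2 * \tr B.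
  rewrite mxtrace_mulC !mulmxA -!mulmxA mulmxA.
  apply: le_trans (tr_conj_diag_le psdB xe).
  rewrite !mulmxA -[_ *m B *m _]mulmxA -!mulmxA mulmxA; apply: tr_proj_mul_le => //.
  by have := psdmx_conj (diag_mx x) psdB; rewrite tr_diag_mx mulmxA.
have := tr_conj_diag_le psdB yf.
move: h; set p := \tr _; set q := \tr _; set s := \tr _; set b := \tr B.
have f2 : 0 < e / f by rewrite divr_gt0.
move=> h1 h2 h3; rewrite -(ler_pM2l (_ : 0 < 2 * (e / f))) ?mulr_gt0 ?invr_gt0 //.
apply: (le_trans h1); apply: (@le_trans _ _ (e ^+ 2 * b + (e / f) ^+ 2 * (f ^+ 2 * b))).
  by apply: lerD => //; rewrite ler_wpM2l // sqr_ge0.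
by rewrite le_eqVlt; apply/orP; left; apply/eqP; field; rewrite gt_eqF.
Qed.

End PositiveSemidefinite.

(** * Perturbation of the normalized matrix *)

Section MinimumDegree.
Variable R : realType.

Lemma vmin_le (n : nat) (v : 'cV[R]_n) (i : 'I_n) : vmin v <= v i 0.
Proof. by case: n v i => [v []|n v i] //=; exact: bigmin_le. Qed.

Lemma lt_vmin (n : nat) (v : 'cV[R]_n) (c : R) :
  (0 < n)%N -> (forall i, c < v i 0) -> c < vmin v.
Proof. by case: n v => //= n v _ cv; apply: lt_bigmin. Qed.

(** The degree is the form [B] at a basis vector and the ones vector. The form is at most [\tr B] on
    the first and [n \tr B] on the second, whence the factor [sqrt n]. *)
Lemma degree_diff_le (n : nat) (B : 'M[R]_n) (i : 'I_n) :
  psdmx B -> `|degree B i 0| <= Num.sqrt n%:R * \tr B.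
Proof.
move=> psdB; set q : R := Num.sqrt n%:R.
have q2 : q ^+ 2 = n%:R by rewrite sqr_sqrtr ?ler0n.
have q_gt0 : 0 < q by rewrite sqrtr_gt0 ltr0n (leq_ltn_trans _ (ltn_ord i)).
pose one : 'cV[R]_n := const_mx 1; pose e : 'cV[R]_n := delta_mx i 0.
have diagE : \tr (e^T *m B *m e) = B i i.
  by rewrite /e trmx_delta -rowE -colE /mxtrace big_ord1 !mxE.
have degE : \tr (e^T *m B *m one) = degree B i 0.
  by rewrite /e trmx_delta -rowE -row_mul /mxtrace big_ord1 mxE.
have Bii : B i i <= \tr B.
  rewrite /mxtrace (bigD1 i) //= lerDl sumr_ge0 // => j _.
  exact: psdmx_diag_ge0.
have B11 : \tr (one^T *m B *m one) <= q ^+ 2 * \tr B.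
  have h j l : 2 * B j l <= B j j + B l l.
    have := psdmx_amgm (delta_mx j (0 : 'I_1)) (delta_mx l (0 : 'I_1)) 1 psdB.
    rewrite !trmx_delta -!rowE -!colE /mxtrace !big_ord1 !mxE.
    by rewrite mulr1 expr1n mul1r.
  rewrite /mxtrace big_ord1 mxE (eq_bigr (fun l => \sum_j B j l)); last first.
    move=> l _; rewrite !mxE mulr1; apply: eq_bigr => j _.
    by rewrite !mxE mul1r.
  rewrite -(ler_pM2l (_ : 0 < 2)) // mulr_sumr.
  apply: (@le_trans _ _ (\sum_(l < n) \sum_(j < n) (B j j + B l l))).
    by apply: ler_sum => l _; rewrite mulr_sumr; apply: ler_sum => j _.
  rewrite (eq_bigr (fun l => \tr B + n%:R * B l l)); last first.
    by move=> l _; rewrite big_split /= sumr_const card_ord mulr_natl.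
  rewrite big_split /= sumr_const card_ord -mulr_sumr -/(\tr B) q2 -mulr_natl.
  by rewrite le_eqVlt; apply/orP; left; apply/eqP; ring.
(* The signs [c = 1] and [c = -1] give the two halves of the absolute value; dividing by [q]
   balances the two diagonal terms. *)
have bound c : c ^+ 2 = 1 -> c * degree B i 0 <= q * \tr B.
  move=> c2; have := psdmx_amgm e one (c / q) psdB.
  rewrite diagE degE exprMn c2 mul1r exprVn => h.
  rewrite -(ler_pM2l (_ : 0 < 2 / q)) ?divr_gt0 //.
  have -> : 2 / q * (c * degree B i 0) = 2 * (c / q) * degree B i 0 by ring.
  apply: (le_trans h).
  have -> : 2 / q * (q * \tr B) = \tr B + (q ^+ 2)^-1 * (q ^+ 2 * \tr B).
    by field; rewrite gt_eqF.
  by rewrite lerD // ler_pM2l // invr_gt0 exprn_gt0.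
rewrite ler_norml; apply/andP; split; last first.
  by have := bound 1 (expr1n _ _); rewrite mul1r.
by rewrite lerNl -mulN1r bound // sqrrN expr1n.
Qed.

(** Rationalizing turns the difference into [(x - y) / ((a + b) a b)], whose denominator is at least
    [2 c^3]. *)
Lemma invsqrt_diff_le (x y z tau : R) :
  0 < z -> z <= x -> z <= y -> `|x - y| <= tau ->
  `|(Num.sqrt y)^-1 - (Num.sqrt x)^-1| <= tau / (2 * Num.sqrt z ^+ 3).
Proof.
move=> z_gt0 zx zy xy; have tau_ge0 : 0 <= tau by exact: le_trans xy.
have x_gt0 := lt_le_trans z_gt0 zx; have y_gt0 := lt_le_trans z_gt0 zy.
set a := Num.sqrt x; set b := Num.sqrt y; set c := Num.sqrt z.
have c_gt0 : 0 < c by rewrite sqrtr_gt0.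
have ca : c <= a by rewrite ler_wsqrtr.
have cb : c <= b by rewrite ler_wsqrtr.
have a_gt0 := lt_le_trans c_gt0 ca; have b_gt0 := lt_le_trans c_gt0 cb.
have -> : b^-1 - a^-1 = (x - y) / ((a + b) * (a * b)).
  rewrite -(sqr_sqrtr (ltW x_gt0)) -(sqr_sqrtr (ltW y_gt0)) -/a -/b.
  by field; rewrite !gt_eqF // addr_gt0.
have h : 2 * c ^+ 3 <= (a + b) * (a * b).
  have -> : 2 * c ^+ 3 = (c + c) * (c * c) by ring.
  by rewrite ler_pM ?addr_ge0 ?mulr_ge0 ?lerD ?ler_pM // ltW.
have p_gt0 : 0 < 2 * c ^+ 3 by rewrite mulr_gt0 // exprn_gt0.
have ab_gt0 := lt_le_trans p_gt0 h.
rewrite normrM normfV (gtr0_norm ab_gt0); apply: ler_pM => //.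
  by rewrite invr_ge0 ltW.
by rewrite lef_pV2 ?posrE.
Qed.

(** The deterministic half. Of the four terms of the decomposition, the first yields [1 / dmin K],
    the two mixed ones together the [delta ^+ 2] term, and the last the [delta ^+ 3] term. *)
Lemma normalize_diff_lt (n : nat) (K Kt : 'M[R]_n) (tau : R) :
  let q := Num.sqrt n%:R in
  let delta := dmin K - q * tau in
  (0 < n)%N -> psdmx K -> psdmx Kt -> psdmx (K - Kt) ->
  0 < delta -> \tr (K - Kt) < tau ->
  delta < dmin Kt /\
  trace_norm (normalize K - normalize Kt) <
    ((dmin K)^-1 + q * \tr K / delta ^+ 2
     + n%:R * \tr K * tau / (4 * delta ^+ 3)) * tau.
Proof.
move=> q delta n_gt0 psdK psdKt psdD delta_gt0 trD.
have q_gt0 : 0 < q by rewrite sqrtr_gt0 ltr0n.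
have q2 : q ^+ 2 = n%:R by rewrite sqr_sqrtr ?ler0n.
have tau_gt0 : 0 < tau by apply: le_lt_trans trD; exact: psdmx_tr_ge0.
have delta_le : delta < dmin K by rewrite /delta ltrBlDr ltrDl mulr_gt0.
have dmin_gt0 : 0 < dmin K by exact: lt_trans delta_le.
have degD i : `|degree K i 0 - degree Kt i 0| < q * tau.
  have -> : degree K i 0 - degree Kt i 0 = degree (K - Kt) i 0.
    by rewrite /degree mulmxBl !mxE.
  by apply: le_lt_trans (degree_diff_le i psdD) _; rewrite ltr_pM2l.
have degK i : dmin K <= degree K i 0 by exact: vmin_le.
have degKt i : delta < degree Kt i 0.
  have := degD i; rewrite ltr_norml => /andP[_].
  have := degK i; rewrite /delta; lra.
split; first exact: lt_vmin.
have [W [WW ->]] := trace_norm_dual (normalize K - normalize Kt).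
pose dK : 'rV[R]_n := \row_i (Num.sqrt (degree K i 0))^-1.
pose E : 'rV[R]_n := \row_i ((Num.sqrt (degree Kt i 0))^-1 - (Num.sqrt (degree K i 0))^-1).
have normK : normalize K = diag_mx dK *m K *m diag_mx dK by [].
have normKt : normalize Kt = diag_mx (dK + E) *m Kt *m diag_mx (dK + E).
  rewrite /normalize; congr (diag_mx _ *m _ *m diag_mx _);
    by apply/rowP => i; rewrite !mxE addrC subrK.
have -> : normalize K - normalize Kt =
    diag_mx dK *m (K - Kt) *m diag_mx dK + diag_mx (- E) *m Kt *m diag_mx dK
    + diag_mx dK *m Kt *m diag_mx (- E) + diag_mx (- E) *m Kt *m diag_mx E.
  rewrite normK normKt !linearD !linearN /= !(mulmxDl, mulmxDr, mulNmx, mulmxN).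
  by rewrite !opprD !addrA; congr (_ + _); rewrite -!addrA; congr (_ + _).
have trD4 A1 A2 A3 A4 : \tr (W *m (A1 + A2 + A3 + A4)) =
    \tr (W *m A1) + \tr (W *m A2) + \tr (W *m A3) + \tr (W *m A4).
  by rewrite !mulmxDr !mxtraceD.
rewrite trD4.
set s := Num.sqrt delta.
have s_gt0 : 0 < s by rewrite sqrtr_gt0.
have s2 : s ^+ 2 = delta by rewrite sqr_sqrtr // ltW.
set e := q * tau / (2 * s ^+ 3).
have e_gt0 : 0 < e by rewrite divr_gt0 ?mulr_gt0 ?exprn_gt0.
have Ee i : `|E 0 i| <= e.
  rewrite mxE; apply: invsqrt_diff_le => //; last exact: ltW.
    by apply: le_trans (degK i); exact: ltW.
  exact: ltW.
have NEe i : `|(- E) 0 i| <= e by rewrite mxE normrN.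
pose f := (Num.sqrt (dmin K))^-1.
have f_gt0 : 0 < f by rewrite invr_gt0 sqrtr_gt0.
have dKf i : `|dK 0 i| <= f.
  rewrite mxE ger0_norm ?invr_ge0 ?sqrtr_ge0 // lef_pV2 ?posrE ?sqrtr_gt0 //.
    exact: ler_wsqrtr.
  exact: lt_le_trans (degK i).
have si_gt0 : 0 < s^-1 by rewrite invr_gt0.
(* This coarser bound serves the mixed terms; the sharper [f] is kept for the first term. *)
have dKs i : `|dK 0 i| <= s^-1.
  apply: (le_trans (dKf i)); rewrite lef_pV2 ?posrE ?sqrtr_gt0 //.
  by rewrite ler_wsqrtr // ltW.
have h1 := tr_isometry_diag_le psdD WW f_gt0 f_gt0 dKf dKf.
have h2 := tr_isometry_diag_le psdKt WW e_gt0 si_gt0 NEe dKs.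
have h3 := tr_isometry_diag_le psdKt WW si_gt0 e_gt0 dKs NEe.
have h4 := tr_isometry_diag_le psdKt WW e_gt0 e_gt0 NEe Ee.
have ff : f * f = (dmin K)^-1 by rewrite -invfM -expr2 sqr_sqrtr // ltW.
have trKt : \tr Kt <= \tr K by rewrite -subr_ge0 -linearB psdmx_tr_ge0.
(* The strictness of the final bound comes from this term. *)
have h1' : f * f * \tr (K - Kt) < (dmin K)^-1 * tau.
  by rewrite ff ltr_pM2l // invr_gt0.
have es : e * s^-1 * \tr Kt <= e * s^-1 * \tr K by rewrite ler_pM2l // mulr_gt0.
have se : s^-1 * e * \tr Kt <= s^-1 * e * \tr K by rewrite ler_pM2l // mulr_gt0.
have ee : e * e * \tr Kt <= e * e * \tr K by rewrite ler_pM2l // mulr_gt0.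
have -> : ((dmin K)^-1 + q * \tr K / delta ^+ 2
     + n%:R * \tr K * tau / (4 * delta ^+ 3)) * tau =
  (dmin K)^-1 * tau + e * s^-1 * \tr K + s^-1 * e * \tr K + e * e * \tr K.
  rewrite -s2 -q2 /e; field; rewrite !gt_eqF //.
apply: le_lt_trans (lerD (lerD (lerD h1 (le_trans h2 es)) (le_trans h3 se)) (le_trans h4 ee)) _.
by rewrite !ltrD2r.
Qed.

End MinimumDegree.

(** * Residuals of Nystrom approximations *)

Section Nystrom.
Variable R : realType.

Lemma gram_unit (m n : nat) (A : 'M[R]_(m, n)) : row_full A -> A^T *m A \in unitmx.
Proof.
move=> fullA; rewrite -row_free_unit; apply/row_freeP.
suff ker0 : kermx (A^T *m A) = 0.
  have /eqP : kermx (A^T *m A) == 0 by rewrite ker0.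
  move=> /eqP; rewrite kermx_eq0 => /row_freeP[X XA]; by exists X.
set Z := kermx _; have Z0 : Z *m (A^T *m A) = 0 by exact: mulmx_ker.
have AZ : A *m Z^T = 0.
  apply: gram_tr_eq0; rewrite trmx_mul trmxK -mulmxA [A^T *m _]mulmxA.
  by rewrite mulmxA Z0 mul0mx mxtrace0.
have /row_fullP[X XA] := fullA.
by rewrite -[Z]trmxK -[Z^T]mul1mx -XA -mulmxA AZ mulmx0 trmx0.
Qed.

(* With a full rank factorization A = C B the pseudoinverse is
   B^T (B B^T)^-1 (C^T C)^-1 C^T. *)
Lemma mpinv_exists (m n : nat) (A : 'M[R]_(m, n)) : exists X, is_mpinv A X.
Proof.
have : exists k (C : 'M[R]_(m, k)) (B : 'M[R]_(k, n)),
    [/\ C *m B = A, row_full C & row_free B].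
  exists (\rank A), (col_base A), (row_base A).
  by rewrite mulmx_base col_base_full row_base_free.
move=> [k [C [B [<- /gram_unit uC freeB]]]].
have uB : B *m B^T \in unitmx.
  have := @gram_unit _ _ B^T; rewrite trmxK; apply.
  by rewrite /row_full mxrank_tr.
pose P := invmx (C^T *m C) *m C^T; pose Q := B^T *m invmx (B *m B^T).
have PC : P *m C = 1%:M by rewrite -mulmxA mulVmx.
have BQ : B *m Q = 1%:M by rewrite mulmxA mulmxV.
exists (Q *m P).
have AX : C *m B *m (Q *m P) = C *m P.
  by rewrite mulmxA -[C *m B *m Q]mulmxA BQ mulmx1.
have XA : Q *m P *m (C *m B) = Q *m B.
  by rewrite mulmxA -[Q *m P *m C]mulmxA PC mulmx1.
split; rewrite ?AX ?XA.
- by rewrite mulmxA -[C *m P *m C]mulmxA PC mulmx1.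
- by rewrite mulmxA -[Q *m B *m Q]mulmxA BQ mulmx1.
- by rewrite /P !trmx_mul trmx_inv trmx_mul !trmxK mulmxA.
- by rewrite /Q !trmx_mul trmx_inv trmx_mul !trmxK mulmxA.
Qed.

(** Existence rules out the default value of [xget]. *)
Lemma mulmx_mpinvK (m n : nat) (A : 'M[R]_(m, n)) : A *m mpinv A *m A = A.
Proof.
have [X AX] := mpinv_exists A.
by rewrite /mpinv; case: xgetP => [Y _ []|/(_ X)].
Qed.

(* For psd K these conditions characterize the residual K - nystrom K S: it is
   the unique K - K Y that vanishes on the rows in S with Y supported there. *)
Definition is_residual (n : nat) (K : 'M[R]_n) (S : {set 'I_n}) (X : 'M[R]_n) :=
  (forall i j, i \in S -> X i j = 0) /\
  exists2 Y : 'M[R]_n, (forall i j, i \notin S -> Y i j = 0) & X = K - K *m Y.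

Lemma tr_mul_supported0 (n : nat) (S : {set 'I_n}) (X Y : 'M[R]_n) :
  (forall i j, i \in S -> X i j = 0) -> (forall i j, i \notin S -> Y i j = 0) ->
  Y^T *m X = 0.
Proof.
move=> XS YS; apply/matrixP => i j; rewrite !mxE big1 // => l _; rewrite mxE.
by case: (boolP (l \in S)) => lS; [rewrite XS ?mulr0 | rewrite YS ?mul0r].
Qed.

(** The difference [K *m (Y' - Y)] vanishes on the rows where [Y' - Y] lives, so the form [K] is
    zero at [Y' - Y] and [psdmx_null] applies. *)
Lemma residual_unique (n : nat) (K X X' : 'M[R]_n) (S : {set 'I_n}) :
  psdmx K -> is_residual K S X -> is_residual K S X' -> X = X'.
Proof.
move=> psdK [XS [Y YS XE]] [XS' [Y' YS' XE']].
have DE : X - X' = K *m (Y' - Y).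
  rewrite XE XE' mulmxBr opprB addrC addrA subrK.
  by rewrite addrC.
apply/eqP; rewrite -subr_eq0 DE; apply/eqP/psdmx_null => //.
rewrite -mulmxA -DE; apply: (@tr_mul_supported0 _ S) => i j iS.
  by rewrite !mxE XS // XS' // subrr.
by rewrite !mxE YS // YS' // subrr.
Qed.

(** The orthogonality [Y^T *m X = 0] exhibits both [X] and [K - X] as congruences of [K]. *)
Lemma residual_psd (n : nat) (K X : 'M[R]_n) (S : {set 'I_n}) :
  psdmx K -> is_residual K S X -> psdmx X /\ psdmx (K - X).
Proof.
move=> psdK [XS [Y YS XE]].
have YX : Y^T *m X = 0 by exact: (@tr_mul_supported0 _ S).
have XX : X = (1%:M - Y)^T *m K *m (1%:M - Y).
  rewrite -mulmxA mulmxBr mulmx1 -XE linearB /= trmx1 mulmxBl mul1mx.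
  by rewrite YX subr0.
have psdX : psdmx X by rewrite XX; exact: psdmx_conj.
split=> //; have KX : K - X = K *m Y by rewrite XE opprB addrC subrK.
have : (K - X)^T = K - X by rewrite linearB /= (proj1 psdK) (proj1 psdX).
move=> sKX; have -> : K - X = Y^T *m K *m Y.
  by rewrite -mulmxA -KX mulmxBr YX subr0 -sKX KX trmx_mul (proj1 psdK).
exact: psdmx_conj.
Qed.

Lemma residual0 (n : nat) (K : 'M[R]_n) : is_residual K finset.set0 K.
Proof.
split; first by move=> i j; rewrite inE.
by exists 0; [move=> i j _; rewrite mxE | rewrite mulmx0 subr0].
Qed.

(** One Cholesky elimination (a Schur complement) preserves the characterization; with uniqueness it
    identifies the recursive and the Nystrom residuals. *)
Lemma residual_step (n : nat) (K X : 'M[R]_n) (S : {set 'I_n}) (j : 'I_n) :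
  is_residual K S X -> X j j != 0 ->
  is_residual K (j |: S) (X - (X j j)^-1 *: (col j X *m row j X)).
Proof.
move=> [XS [Y YS XE]] nz; split.
  move=> i l; rewrite !mxE big_ord1 !mxE in_setU1 => /orP[/eqP ->|iS].
    by rewrite mulKf // subrr.
  by rewrite !(XS i) // mul0r mulr0 subrr.
pose Z : 'M[R]_n := (X j j)^-1 *: (delta_mx j 0 *m row j X).
(* The new residual is [K (1 - Y) (1 - Z)]; this witness is [1 - (1 - Y) (1 - Z)]. *)
exists (Y + Z - Y *m Z).
  move=> i l; rewrite in_setU1 negb_or => /andP[ij iS].
  rewrite !mxE YS // big_ord1 !mxE (negbTE ij) mul0r mulr0 add0r sub0r.
  by rewrite big1 ?oppr0 // => h _; rewrite YS ?mul0r.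
have -> : (X j j)^-1 *: (col j X *m row j X) = X *m Z.
  by rewrite colE -scalemxAr mulmxA.
rewrite XE mulmxBl mulmxBr mulmxDr !mulmxA.
by rewrite opprB opprB addrA opprD -!addrA; congr (_ + _); rewrite addrCA.
Qed.

Lemma nystrom_residual (n : nat) (K : 'M[R]_n) (S : {set 'I_n}) :
  psdmx K -> is_residual K S (K - nystrom K S).
Proof.
move=> psdK; pose f : 'I_#|S| -> 'I_n := enum_val.
pose E : 'M[R]_(n, #|S|) := colsub f 1%:M.
have KE : colsub f K = K *m E.
  by rewrite /E mulmx_colsub mulmx1.
have AE : mxsub f f K = E^T *m (K *m E).
  rewrite -KE /E trmx_mxsub trmx1 mul_rowsub_mx mul1mx.
  by apply/matrixP => i j; rewrite !mxE.
set A := mxsub f f K in AE *; pose X := mpinv A.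
have AXA : A *m X *m A = A by exact: mulmx_mpinvK.
have sA : A^T = A by rewrite AE !trmx_mul trmxK (proj1 psdK) mulmxA.
have nysE : nystrom K S = K *m (E *m X *m E^T *m K).
  rewrite /nystrom -/f -/A -/X KE trmx_mul (proj1 psdK) !mulmxA.
  by [].
split; last first.
  exists (E *m X *m E^T *m K); last by rewrite nysE.
  move=> i j iS; rewrite -!mulmxA mxE big1 // => l _; rewrite !mxE.
  have -> : (i == f l) = false.
    by apply/eqP => il; move: iS; rewrite il /f enum_valP.
  by rewrite mul0r.
(* The product equals [(1 - A X) E^T K]. As [A X A = A], the form [K] vanishes at [E *m H], hence so
   does [K *m (E *m H)], even for singular [A]. *)
have range0 : E^T *m (K - nystrom K S) = 0.
  pose H := (1%:M - A *m X)^T.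
  have : K *m (E *m H) = 0.
    apply: psdmx_null => //; rewrite trmx_mul -!mulmxA.
    have AH : A *m H = 0.
      apply: trmx_inj; rewrite trmx_mul trmxK sA mulmxBl mul1mx AXA.
      by rewrite subrr trmx0.
    by rewrite [K *m (E *m _)]mulmxA [E^T *m (_ *m _)]mulmxA -AE AH mulmx0.
  move/(congr1 trmx); rewrite trmx0 !trmx_mul /H trmxK (proj1 psdK).
  rewrite -mulmxA mulmxBl mul1mx nysE mulmxBr AE !mulmxA => h.
  by rewrite -[RHS]h.
move=> i j iS; have := congr1 (fun M : 'M[R]_(_, _) => M (enum_rank_in iS i) j) range0.
rewrite mxE [RHS]mxE (bigD1 i) //= big1.
  by rewrite !mxE /f enum_rankK_in // eqxx mul1r addr0.
move=> l li; rewrite !mxE /f enum_rankK_in // (_ : (l == i) = false) ?mul0r //.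
exact/negbTE.
Qed.

End Nystrom.

(** * Expected trace of the residual *)

Section PotentialDescent.
Variable R : realType.

(* The potential m ln a - m b / a is concave in a, with derivative m (a + b) / a^2. *)
Lemma potential_step (m b x y : R) :
  0 < m -> 0 < b -> 0 < x -> 0 < y -> y <= x - x ^+ 2 / (m * (x + b)) ->
  m * ln y - m * b / y + 1 <= m * ln x - m * b / x.
Proof.
move=> m_gt0 b_gt0 x_gt0 y_gt0 hy.
have xb : 0 < x + b by rewrite addr_gt0.
(* [hln] and [hinv] are the tangent line bounds at [x] for the two parts of the potential; [hd] then
   says that derivative times increment is at most -1. *)
have hln : ln y - ln x <= y / x - 1.
  rewrite -ln_div ?posrE //; apply: le_trans (le_ln1Dx (x := y / x - 1) _).
    by rewrite addrC subrK.
  by rewrite ltrBrDl subrr divr_gt0.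
have hinv : x^-1 - (y - x) / x ^+ 2 <= y^-1.
  rewrite -subr_ge0.
  have -> : y^-1 - (x^-1 - (y - x) / x ^+ 2) = (y - x) ^+ 2 / (x ^+ 2 * y).
    by field; rewrite ?gt_eqF.
  by rewrite divr_ge0 ?sqr_ge0 // mulr_ge0 ?sqr_ge0 // ltW.
have hd : m * ((y - x) * (x + b) / x ^+ 2) <= - 1.
  have -> : m * ((y - x) * (x + b) / x ^+ 2) =
      (y - x) * (m * (x + b) / x ^+ 2) by ring.
  have -> : - 1 = - (x ^+ 2 / (m * (x + b))) * (m * (x + b) / x ^+ 2).
    by field; rewrite ?gt_eqF.
  rewrite ler_wpM2r //; first by rewrite divr_ge0 ?sqr_ge0 // ltW // mulr_gt0.
  by rewrite lerBlDl.
have : m * (ln y - ln x) + m * b * (x^-1 - y^-1) <=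
    m * (y / x - 1) + m * b * ((y - x) / x ^+ 2).
  apply: lerD; first by rewrite ler_pM2l.
  by rewrite ler_pM2l ?mulr_gt0 // lerBlDl -lerBlDr.
have -> : m * (y / x - 1) + m * b * ((y - x) / x ^+ 2) =
    m * ((y - x) * (x + b) / x ^+ 2) by field; rewrite ?gt_eqF.
move=> h; have := le_trans h hd; rewrite -!mulrA; lra.
Qed.

(** While [a i] exceeds [eps * b] the potential drops by 1 per step, but there it stays above
    [m ln (eps b) - m / eps], while it starts below [m ln A]. So at most the stated number of steps
    is possible. *)
Lemma descent_le (a : nat -> R) (m b eps A : R) (k : nat) :
  0 < m -> 0 < b -> 0 < eps -> (forall i, 0 <= a i) ->
  (forall i, a i.+1 <= a i - a i ^+ 2 / (m * (a i + b))) ->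
  a 0%N <= A -> m / eps + m * ln (A / (eps * b)) <= k%:R ->
  a k <= eps * b.
Proof.
move=> m_gt0 b_gt0 eps_gt0 a_ge0 a_step aA hk.
have eb : 0 < eps * b by rewrite mulr_gt0.
have dec i : a i.+1 <= a i.
  apply: (le_trans (a_step i)); rewrite gerBl divr_ge0 ?sqr_ge0 // mulr_ge0 ?ltW //.
  by rewrite ltr_wpDl.
pose phi i := m * ln (a i) - m * b / a i.
have alt i : a i <= eps * b \/ (eps * b < a i /\ phi i + i%:R <= phi 0%N).
  elim: i => [|i IH].
    by case: (leP (a 0%N) (eps * b)) => h; [left | right; rewrite addr0].
  case: IH => [le_eb|[gt_eb hphi]]; first by left; exact: le_trans (dec i) le_eb.
  case: (leP (a i.+1) (eps * b)) => h; [by left | right; split=> //].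
  have := potential_step m_gt0 b_gt0 (lt_trans eb gt_eb) (lt_trans eb h) (a_step i).
  move: hphi; rewrite /phi -natr1; lra.
case: (alt k) => // -[gt_eb hphi].
have ak : 0 < a k by exact: lt_trans eb gt_eb.
have a0 : 0 < a 0%N.
  elim: k ak {gt_eb hphi hk} => // k IH h; exact/IH/(lt_le_trans h).
have A_gt0 : 0 < A by exact: lt_le_trans aA.
have h4 : m * ln (a 0%N) <= m * ln A by rewrite ler_pM2l // ler_ln ?posrE.
have h1 : ln (eps * b) < ln (a k) by rewrite ltr_ln ?posrE.
have h2 : b / a k < eps^-1.
  by rewrite ltr_pdivrMr // mulrC ltr_pdivlMr // mulrC.
have h3 : 0 < m * b / a 0%N by rewrite divr_gt0 // mulr_gt0.
move: hk hphi; rewrite /phi ln_div ?posrE // -!mulrA.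
have := ltr_pM2l m_gt0 (ln (eps * b)) (ln (a k)); rewrite h1 => h1'.
have := ltr_pM2l m_gt0 (b / a k) eps^-1; rewrite h2 => h2'.
move: h3; rewrite -mulrA; lra.
Qed.

End PotentialDescent.

(** * Mean decrease of the projected trace under one pivot *)

Section RandomlyPivotedCholesky.
Variable R : realType.

Lemma lowrank_proj (n r : nat) (K : 'M[R]_n) :
  exists P : 'M[R]_n, [/\ P^T = P, P *m P = P, \tr P <= r%:R
    & \tr (lowrank K r) = \tr (P *m K)].
Proof.
rewrite /lowrank /eigvec /eigval /eigendec.
case: xgetP => [[V s] _ [/= VV _ KE]|_]; last first.
  (* On the default eigendecomposition [lowrank] is zero, so the zero projection fits. *)
  exists 0; rewrite /= !mul0mx !linear0; split=> //; exact: ler0n.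
pose J : 'rV[R]_n := \row_(i < n) (if (i < r)%N then 1 else 0).
have trV (h : 'rV[R]_n) : \tr (V *m diag_mx h *m V^T) = \sum_i h 0 i.
  by rewrite mxtrace_mulC mulmxA VV mul1mx mxtrace_diag.
exists (V *m diag_mx J *m V^T); split.
- by rewrite !trmx_mul trmxK tr_diag_mx mulmxA.
- rewrite !mulmxA -[_ *m V^T *m V]mulmxA VV mulmx1 -[V *m _ *m _]mulmxA mulmx_diag.
  congr (_ *m diag_mx _ *m _); apply/rowP => i; rewrite !mxE.
  by case: ifP; rewrite ?mulr1 ?mulr0.
- rewrite trV (eq_bigr (fun i : 'I_n => if (i < r)%N then 1 else 0)); last first.
    by move=> i _; rewrite mxE.
  rewrite -big_mkcond sumr_const ler_nat.
  rewrite cardE -[leqRHS](size_iota 0) -(size_map val).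
  apply: uniq_leq_size; first by rewrite map_inj_uniq ?enum_uniq //; exact: val_inj.
  by move=> j /mapP[i]; rewrite mem_enum mem_iota => ir ->.
rewrite KE !mulmxA -[_ *m V^T *m V]mulmxA VV mulmx1 -[V *m _ *m diag_mx s]mulmxA.
rewrite mulmx_diag !trV; apply: eq_bigr => i _; rewrite !mxE.
by case: ifP; rewrite ?mul1r ?mul0r.
Qed.

(* The sum over j is the mean of tr (P X') for the updated residual X'; it
   equals tr (P X) - tr (X P X) / tr X. *)
Lemma residual_drift (n : nat) (X P : 'M[R]_n) (b c m : R) :
  psdmx X -> P^T = P -> P *m P = P -> \tr P <= m -> 0 < m ->
  \tr ((1%:M - P) *m X) <= b -> \tr X != 0 ->
  \sum_j X j j / \tr X * \tr (P *m (X - (X j j)^-1 *: (col j X *m row j X))) <=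
  \tr (P *m X) - (2 * c * \tr (P *m X) - c ^+ 2 * (\tr (P *m X) + b)) / m.
Proof.
move=> psdX sP iP trP m_gt0 trQ T_neq0.
set x := \tr (P *m X); set T := \tr X in T_neq0 *.
have T_gt0 : 0 < T by rewrite lt_def T_neq0 psdmx_tr_ge0.
have TE : T <= x + b.
  by move: trQ; rewrite mulmxBl mul1mx linearB /= -/T -/x lerBlDl.
(* A zero diagonal entry of a psd matrix kills its column, so the mean formula survives the
   convention [0^-1 = 0]. *)
have colE0 j : X j j = 0 -> col j X = 0.
  move=> Xj; rewrite colE; apply: psdmx_null => //.
  apply/matrixP => i l; rewrite trmx_delta -rowE -colE !mxE.
  by rewrite Xj.
have -> : \sum_j X j j / T * \tr (P *m (X - (X j j)^-1 *: (col j X *m row j X))) =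
    x - \tr (X *m P *m X) / T.
  rewrite (eq_bigr (fun j => X j j / T * x - (X *m P *m X) j j / T)).
    by rewrite sumrB -!mulr_suml -/(\tr X) divff // mul1r.
  move=> j _; rewrite mulmxBr linearB /= -/x mulrBr; congr (_ - _).
  rewrite -scalemxAr linearZ /= mulmxA mxtrace_mulC mulmxA.
  have -> : \tr (row j X *m P *m col j X) = (X *m P *m X) j j.
    rewrite -row_mul /mxtrace big_ord1 [LHS]mxE [RHS]mxE.
    by apply: eq_bigr => l _; rewrite [row _ _ _ _]mxE [col _ _ _ _]mxE.
  have [Xj|Xj] := eqVneq (X j j) 0; last by field; rewrite Xj andbT.
  have -> : (X *m P *m X) j j = (col j (X *m P *m X)) j 0 by rewrite [RHS]mxE.
  by rewrite colE -mulmxA -colE (colE0 j Xj) mulmx0 mxE Xj !mul0r.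
rewrite lerB // ler_pdivrMr // [leRHS]mulrAC ler_pdivlMr //.
have psd1 : psdmx (1%:M : 'M[R]_n).
  split; first exact: trmx1.
  move=> v; rewrite mulmx1 mxE sumr_ge0 // => i _.
  by rewrite mxE -expr2 sqr_ge0.
(* This replaces [\tr (P X)^2 <= \tr P * \tr (X P X)]; keeping [c] free leaves a bound affine in
   [\tr (P X)], through which means can pass. *)
have := psdmx_amgm (P *m X) P (c * T / m) psd1.
rewrite !trmx_mul sP (proj1 psdX) !mulmx1 -!mulmxA iP [P *m (P *m X)]mulmxA iP.
have -> : \tr (X *m P) = x by rewrite mxtrace_mulC.
rewrite mulmxA.
set q := \tr (X *m P *m X) => h.
have q_ge : 2 * (c * T / m) * x - (c * T / m) ^+ 2 * m <= q.
  rewrite lerBlDr; apply: (le_trans h); rewrite lerD2l.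
  by rewrite ler_wpM2l // sqr_ge0.
apply: (@le_trans _ _ ((2 * (c * T / m) * x - (c * T / m) ^+ 2 * m) * m)); last first.
  by rewrite ler_pM2r.
have -> : (2 * (c * T / m) * x - (c * T / m) ^+ 2 * m) * m =
   (2 * c * x - c ^+ 2 * T) * T by field; rewrite gt_eqF.
by rewrite ler_pM2r // lerB // ler_wpM2l // sqr_ge0.
Qed.

End RandomlyPivotedCholesky.

(** * Means over the pivot sequence *)

Section ExpectedTrace.
Variables (R : realType) (n : nat) (K : 'M[R]_n).
Hypothesis psdK : psdmx K.
Implicit Types (p : seq (option 'I_n)) (f g : seq (option 'I_n) -> R).

(* Conditional expectation of f applied to the draws after i more steps, given
   the past draws p. *)
Fixpoint rpc_mean (i : nat) f p : R :=
  if i is i'.+1 then \sum_x rpc_step K p x * rpc_mean i' f (rcons p x) else f p.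

Let resid p := K - rpc_approx K p.

Lemma resid_is_residual p : is_residual K (pivot_set p) (resid p).
Proof. exact: nystrom_residual. Qed.

Lemma resid_psd p : psdmx (resid p).
Proof. by have [] := residual_psd psdK (resid_is_residual p). Qed.

Lemma resid_nil : resid [::] = K.
Proof.
apply: (residual_unique psdK (resid_is_residual _)).
have -> : pivot_set [::] = finset.set0 :> {set 'I_n}.
  by apply/finset.setP => j; rewrite !inE.
exact: residual0.
Qed.

Lemma resid_None p : resid (rcons p None) = resid p.
Proof.
rewrite /resid /rpc_approx; congr (_ - nystrom K _).
by apply/finset.setP => j; rewrite !inE mem_rcons inE.
Qed.

Lemma resid_Some p j : resid p j j != 0 ->
  resid (rcons p (Some j)) =
  resid p - (resid p j j)^-1 *: (col j (resid p) *m row j (resid p)).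
Proof.
move=> nz; apply: (residual_unique psdK (resid_is_residual _)).
have -> : pivot_set (rcons p (Some j)) = (j |: pivot_set p)%SET.
  by apply/finset.setP => l; rewrite !inE mem_rcons inE.
exact/residual_step/nz/resid_is_residual.
Qed.

Lemma rpc_step_ge0 p x : 0 <= rpc_step K p x.
Proof.
case: x => [j|] /=; last by case: ifP.
by rewrite divr_ge0 ?sumr_ge0 // => *; apply: psdmx_diag_ge0 (resid_psd p).
Qed.

Lemma rpc_step_stopped p : \tr (resid p) = 0 ->
  rpc_step K p = (fun x => (x == None)%:R).
Proof.
move=> tr0; have r0 l : rpc_residual K p l = 0.
  by apply: (psumr_eq0P _ tr0) => // i _; apply: psdmx_diag_ge0 (resid_psd p).
apply: funext => -[j|] /=; first by rewrite r0 mul0r.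
by case: ifP => // /negP[]; apply/forallP => l; rewrite r0.
Qed.

Lemma rpc_step_None p : \tr (resid p) != 0 -> rpc_step K p None = 0.
Proof.
move=> tr0 /=; case: ifP => // /forallP r0; case/negP: tr0.
by apply/eqP/big1 => l _; apply/eqP/r0.
Qed.

Lemma sum_option (F : option 'I_n -> R) :
  \sum_x F x = F None + \sum_j F (Some j).
Proof.
rewrite (bigD1 None) //=; congr (_ + _).
rewrite (reindex_omap Some id) /=; last by case.
by apply: eq_bigl => j; rewrite eqxx.
Qed.

Lemma rpc_step_sum1 p : \sum_x rpc_step K p x = 1.
Proof.
have [tr0|tr0] := eqVneq (\tr (resid p)) 0.
  by rewrite rpc_step_stopped // sum_option eqxx big1 ?addr0.
by rewrite sum_option rpc_step_None // add0r -mulr_suml divff.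
Qed.

Lemma rpc_mean_le i f g p :
  (forall q, f q <= g q) -> rpc_mean i f p <= rpc_mean i g p.
Proof.
move=> fg; elim: i p => //= i IH p; apply: ler_sum => x _.
by rewrite ler_wpM2l ?rpc_step_ge0.
Qed.

Lemma rpc_mean_affine i f a b p :
  rpc_mean i (fun q => a * f q + b) p = a * rpc_mean i f p + b.
Proof.
elim: i p => //= i IH p.
rewrite -[X in _ + X]mul1r -(rpc_step_sum1 p) mulr_sumr mulr_suml -big_split.
by apply: eq_bigr => x _; rewrite IH /=; ring.
Qed.

Lemma rpc_mean_cst i b p : rpc_mean i (fun=> b) p = b.
Proof.
have := rpc_mean_affine i (fun=> 0) 0 b p.
rewrite [X in _ = X + _ -> _]mul0r add0r => h.
apply: etrans h; congr rpc_mean.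
by apply: funext => q; rewrite mul0r add0r.
Qed.

(** The recursion peels off the first draw, whereas the drift estimate concerns the last one. *)
Lemma rpc_mean_last i f p :
  rpc_mean i.+1 f p =
  rpc_mean i (fun q => \sum_x rpc_step K q x * f (rcons q x)) p.
Proof.
elim: i p => // i IH p; rewrite [LHS]/= [RHS]/=; apply: eq_bigr => x _.
by congr (_ * _); exact: IH.
Qed.

(** Transfers [residual_drift] to the algorithm: the residual is below [K], so it inherits the tail
    bound. After stopping, the projected trace is 0 and the right side is [c^2 b / m]. *)
Lemma rpc_drift (P : 'M[R]_n) (b c m : R) p :
  P^T = P -> P *m P = P -> \tr P <= m -> 0 < m -> 0 <= b ->
  \tr ((1%:M - P) *m K) <= b ->
  \sum_x rpc_step K p x * \tr (P *m resid (rcons p x)) <=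
  \tr (P *m resid p)
    - (2 * c * \tr (P *m resid p) - c ^+ 2 * (\tr (P *m resid p) + b)) / m.
Proof.
move=> sP iP trP m_gt0 b_ge0 trQ.
have [sQ iQ] := projC_idem sP iP.
have [tr0|tr0] := eqVneq (\tr (resid p)) 0.
  have x0 : \tr (P *m resid p) = 0.
    apply/eqP; rewrite eq_le (tr_proj_mul_ge0 sP iP (resid_psd p)) andbT -tr0.
    exact: tr_proj_mul_le (resid_psd p).
  rewrite rpc_step_stopped // sum_option /= mul1r resid_None big1 => [|j _]; last by rewrite mul0r.
  rewrite x0 mulr0 !add0r mulNr opprK divr_ge0 //; last exact: ltW.
  by rewrite mulr_ge0 ?sqr_ge0.
apply: le_trans (residual_drift c (resid_psd p) sP iP trP m_gt0 _ tr0); last first.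
  apply: le_trans trQ; rewrite -subr_ge0 -linearB /= -mulmxBr.
  apply: tr_proj_mul_ge0 => //.
  by have [] := residual_psd psdK (resid_is_residual p).
rewrite sum_option rpc_step_None // mul0r add0r; apply: ler_sum => j _.
have [r0|r0] := eqVneq (resid p j j) 0.
  by rewrite /= /rpc_residual -/(resid p) r0 !mul0r.
by rewrite resid_Some.
Qed.

(** The residual trace is at most its projected part plus [tail]; [descent_le] drives the mean of
    the projected part down to [eps * tail]. *)
Lemma rpc_mean_trace (P : 'M[R]_n) (m eps : R) (k : nat) :
  P^T = P -> P *m P = P -> \tr P <= m -> 0 <= m -> 0 < eps ->
  let tail := \tr K - \tr (P *m K) in
  0 < tail ->
  m / eps + m * ln (\tr K / (eps * tail)) <= k%:R ->
  rpc_mean k (fun p => \tr (resid p)) [::] <= (1 + eps) * tail.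
Proof.
move=> sP iP trP m_ge0 eps_gt0 tail b_gt0 hk.
have [sQ iQ] := projC_idem sP iP.
have trQ : \tr ((1%:M - P) *m K) = tail by rewrite mulmxBl mul1mx linearB.
pose x p := \tr (P *m resid p).
have x_ge0 p : 0 <= x p by exact/tr_proj_mul_ge0/resid_psd.
have trE p : \tr (resid p) <= 1 * x p + tail.
  rewrite mul1r addrC -lerBlDr -[leLHS]/(_ - \tr (P *m resid p)) -linearB /=.
  rewrite -[X in \tr (X - _)]mul1mx -mulmxBl -trQ -subr_ge0 -linearB /= -mulmxBr.
  apply: tr_proj_mul_ge0 => //.
  by have [] := residual_psd psdK (resid_is_residual p).
apply: (le_trans (rpc_mean_le _ _ trE)); rewrite rpc_mean_affine.
rewrite mul1r mulrDl mul1r addrC lerD2l.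
pose a i := rpc_mean i x [::].
have a_ge0 i : 0 <= a i.
  by rewrite -(rpc_mean_cst i 0 [::]); exact: rpc_mean_le.
(* The recursion divides by [m]; for [m = 0] the projection is zero and the projected part
   vanishes. *)
move: m_ge0; rewrite le_eqVlt => /orP[/eqP m0|m_gt0].
  have P0 : P = 0.
    apply: gram_tr_eq0; rewrite idem_gram //; apply/eqP.
    rewrite eq_le m0 trP /=.
    by rewrite -m0 -(mulmx1 P) tr_proj_mul // mulmx1 gram_tr_ge0.
  rewrite (_ : x = fun=> 0); last by apply: funext => p; rewrite /x P0 mul0mx linear0.
  by rewrite rpc_mean_cst mulr_ge0 // ltW.
apply: (descent_le m_gt0 b_gt0 eps_gt0 a_ge0 _ _ hk) => [i|].
  (* The supporting line at a i replaces Jensen's inequality: for every c,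
     x^2 / (x + b) >= 2 c x - c^2 (x + b), with equality at x = a i for this c. *)
  pose c := a i / (a i + tail).
  have ab : 0 < a i + tail by rewrite ltr_wpDl.
  rewrite {1}/a rpc_mean_last.
  pose g q := (1 - (2 * c - c ^+ 2) / m) * x q + c ^+ 2 * tail / m.
  apply: (@le_trans _ _ (rpc_mean i g [::])).
    have trQ_le : \tr ((1%:M - P) *m K) <= tail by rewrite trQ.
    apply: rpc_mean_le => q.
    apply: le_trans (rpc_drift c q sP iP trP m_gt0 (ltW b_gt0) trQ_le) _.
    by rewrite le_eqVlt; apply/orP; left; apply/eqP; rewrite /g -/(x q); ring.
  rewrite rpc_mean_affine -/(a i) le_eqVlt; apply/orP; left; apply/eqP.
  by rewrite /c; field; rewrite !gt_eqF.
by rewrite /a /= /x resid_nil tr_proj_mul_le.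
Qed.

End ExpectedTrace.

(** * The law of the pivots *)

Section RunLaw.
Variables (R : realType) (disp : measure_display) (T : measurableType disp).
Variables (P : probability T R) (n : nat) (K : 'M[R]_n) (r : nat).
Variable s : nat -> T -> option 'I_n.
Hypothesis run : rpc_run P K r s.

Lemma draws_recr i w : draws s i.+1 w = rcons (draws s i w) (s i w).
Proof. by rewrite /draws mkseqS. Qed.

Lemma draws_rconsE i p x :
  [set w | draws s i.+1 w = rcons p x] = [set w | draws s i w = p /\ s i w = x].
Proof.
apply/seteqP; split=> w /=; rewrite draws_recr; first by move/rcons_inj => [].
by case=> -> ->.
Qed.

Lemma measurable_draws i p : (i <= r)%N -> measurable [set w | draws s i w = p].
Proof.
elim: i p => [|i IH] p ir.
  by case: p => [|x p]; [rewrite (_ : mkset _ = setT) | rewrite (_ : mkset _ = set0)];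
    try exact: measurableT; try exact: measurable0; apply/seteqP; split.
case/lastP: p => [|p x].
  by rewrite (_ : mkset _ = set0) //; apply/seteqP; split.
rewrite draws_rconsE; apply: measurableI; last exact: (proj1 run).
exact/IH/ltnW.
Qed.

(** Induction on the remaining steps, splitting by the next draw into finitely many disjoint events.
    Measurability is carried along because additivity requires it. *)
Lemma law_given_draws i j p (G : pred (seq (option 'I_n))) : (j + i <= r)%N ->
  let A := [set w | draws s j w = p /\ G (draws s (j + i) w)] in
  measurable A /\
  P A = (P [set w | draws s j w = p] * (rpc_mean K i (fun q => (G q)%:R) p)%:E)%E.
Proof.
elim: i j p => [|i IH] j p jr A.
  rewrite addn0 in jr; have -> : A = if G p then [set w | draws s j w = p] else set0.
    rewrite /A addn0; apply/seteqP; split=> w /=; first by case=> <- ->.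
    by case: ifP => // Gp ->.
  rewrite /=; case: (G p); rewrite /= ?mule1 ?mule0 ?measure0; split=> //.
  exact: measurable_draws.
pose B x := [set w | draws s j.+1 w = rcons p x /\ G (draws s (j.+1 + i) w)].
have jr' : (j.+1 + i <= r)%N by rewrite addSnnS.
have mB x : measurable (B x) by exact: (IH j.+1 (rcons p x) jr').1.
have PB x : P (B x) = (P [set w | draws s j w = p] *
    (rpc_step K p x * rpc_mean K i (fun q => (G q)%:R) (rcons p x))%:E)%E.
  rewrite (IH j.+1 (rcons p x) jr').2 draws_rconsE (proj2 run); last first.
    by apply: leq_trans jr; rewrite addnS ltnS leq_addr.
  by rewrite EFinM muleA.
have AE : A = \bigcup_(x in [set: option 'I_n]) B x.
  apply/seteqP; split=> w.
    case=> dw Gw; exists (s j w) => //; split; last by rewrite addSnnS.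
    by rewrite draws_recr dw.
  by case=> x _ []; rewrite draws_recr addSnnS => /rcons_inj[pE _] Gw; split.
have fin : finite_set [set: option 'I_n] by exact: finite_finset.
rewrite AE; split; first by apply: fin_bigcup_measurable => // x _; exact: mB.
rewrite measure_fin_bigcup //; last first.
  move=> x y _ _ [w [[] + _ [] + _]].
  rewrite !draws_recr => /rcons_inj[_ sx] /rcons_inj[_ sy].
  exact: etrans (esym sx) sy.
rewrite (fsbigE (index_enum (option 'I_n))) ?index_enum_uniq //; last first.
  by move=> x _ /=; rewrite mem_index_enum.
have fineP : P [set w | draws s j w = p] \is a fin_num.
  by apply/fin_num_measure/measurable_draws/(leq_trans _ jr)/leq_addr.
rewrite -(fineK fineP) /= -EFinM mulr_sumr -sumEFin.
rewrite big_mkcond /=; apply: eq_bigr => x _.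
by rewrite in_setT PB -(fineK fineP) -EFinM.
Qed.

Lemma measurable_event (G : pred (seq (option 'I_n))) :
  measurable [set w | G (draws s r w)].
Proof.
have := (@law_given_draws r 0 [::] G (leqnn r)).1; rewrite add0n.
by congr measurable; apply/seteqP; split=> w //= [].
Qed.

Lemma rpc_law (G : pred (seq (option 'I_n))) :
  P [set w | G (draws s r w)] = (rpc_mean K r (fun q => (G q)%:R) [::])%:E.
Proof.
have := (@law_given_draws r 0 [::] G (leqnn r)).2; rewrite add0n.
have -> : [set w | draws s 0 w = [::]] = setT by apply/seteqP; split.
rewrite probability_setT mul1e => <-; congr (P _).
by apply/seteqP; split=> w //= [].
Qed.

(** Markov's inequality inside [rpc_mean]: the indicator of [f < t c] dominates [1 - f / (t c)]
    pointwise. *)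
Lemma rpc_markov (f : seq (option 'I_n) -> R) (c t : R) :
  psdmx K -> (forall q, 0 <= f q) -> 0 < c -> 0 < t ->
  rpc_mean K r f [::] <= c ->
  ((1 - 1 / t)%:E <= P [set w | (f (draws s r w) < t * c)%R])%E.
Proof.
move=> psdK f_ge0 c_gt0 t_gt0 meanf.
rewrite (rpc_law (fun q => f q < t * c)) lee_fin.
have tc_gt0 : 0 < t * c by rewrite mulr_gt0.
apply: (@le_trans _ _ (rpc_mean K r (fun q => - (t * c)^-1 * f q + 1) [::])).
  rewrite rpc_mean_affine // [leRHS]addrC lerD2l mulNr lerN2 div1r invfM -mulrA.
  by rewrite ger_pMr ?invr_gt0 // mulrC ler_pdivrMr // mul1r.
apply: rpc_mean_le => // q; case: ltP => h /=.
  by rewrite gerDr mulNr oppr_le0 mulr_ge0 // invr_ge0 ltW.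
by rewrite mulNr addrC subr_le0 mulrC ler_pdivlMr // mul1r.
Qed.

End RunLaw.

(** * Probabilistic bound for the normalized kernel matrix *)

Theorem corollary5 (R : realType) (d N : nat)
    (k : 'rV[R]_d -> 'rV[R]_d -> R) (u : 'I_N -> 'rV[R]_d)
    (k_cont : kernel_continuous k) (k_bound : kernel_bounded k)
    (k_psd : psd_kernel k) (k_pos : forall x y, 0 < k x y)
    (r' r : nat) (eps t : R)
    (disp : measure_display) (T : measurableType disp) (P : probability T R)
    (s : nat -> T -> option 'I_N) :
  let K := kernel_mx k u in
  let tail := \tr (K - lowrank K r') in
  let zeta := (1 + eps) * tail in
  let eta := tail / \tr K in
  let sqrtN : R := Num.sqrt N%:R in
  let delta := dmin K - sqrtN * t * zeta in
  0 < eps ->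
  0 < tail ->
  (r' <= r < N)%N ->
  r'%:R / eps + r'%:R * ln (1 / (eps * eta)) <= r%:R ->
  1 < t < dmin K / (sqrtN * zeta) ->
  rpc_run P K r s ->
  ((1 - 1 / t)%:E <=
    P [set w | let Kt := rpc_approx K (draws s r w) in
        [/\ delta < dmin Kt, 0 < delta
          & trace_norm (normalize K - normalize Kt) <
            ((dmin K)^-1 + sqrtN * \tr K / delta ^+ 2
             + N%:R * \tr K * t * zeta / (4 * delta ^+ 3)) * (t * zeta)]%R])%E.
Proof.
move=> K tail zeta eta sqrtN delta eps_gt0 tail_gt0 /andP[_ rN] hr /andP[t_gt1 tlt] run.
have psdK : psdmx K by exact: (proj2 k_psd).
have N_gt0 : (0 < N)%N by exact: leq_ltn_trans rN.
have sN_gt0 : 0 < sqrtN by rewrite sqrtr_gt0 ltr0n.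
have t_gt0 : 0 < t by exact: lt_trans t_gt1.
have zeta_gt0 : 0 < zeta by rewrite mulr_gt0 // addr_gt0.
have delta_gt0 : 0 < delta.
  move: tlt; rewrite (ltr_pdivlMr _ _ (mulr_gt0 sN_gt0 zeta_gt0)) => h.
  by rewrite /delta subr_gt0 -mulrA mulrCA.
have [Q [sQ iQ trQ lowE]] := lowrank_proj r' K.
have tailE : tail = \tr K - \tr (Q *m K) by rewrite /tail linearB /= lowE.
have mean_le : rpc_mean K r (fun q => \tr (K - rpc_approx K q)) [::] <= zeta.
  rewrite /zeta tailE.
  apply: (rpc_mean_trace psdK sQ iQ trQ) => //; rewrite -tailE //.
  (* Here [1 / (eps * eta)] becomes [\tr K / (eps * tail)], the ratio of the initial bound to the
     target. *)
  by move: hr; rewrite /eta div1r !invfM invrK [_^-1 * \tr K]mulrC mulrCA -invfM.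
have res q : psdmx (rpc_approx K q) /\ psdmx (K - rpc_approx K q).
  have [psdR] := residual_psd psdK (nystrom_residual (pivot_set q) psdK).
  by rewrite opprB addrC subrK.
apply: le_trans (rpc_markov run psdK _ zeta_gt0 t_gt0 mean_le) _.
  by move=> q; apply: psdmx_tr_ge0; have [] := res q.
apply: le_measure; rewrite ?inE.
- exact: (measurable_event run (fun q => \tr (K - rpc_approx K q) < t * zeta)).
(* The event depends on the run only through its draws, which take finitely many values. *)
- set A := (X in measurable X).
  have := measurable_event run (fun q => `[< let Kt := rpc_approx K q in
        [/\ delta < dmin Kt, 0 < delta
          & trace_norm (normalize K - normalize Kt) <
            ((dmin K)^-1 + sqrtN * \tr K / delta ^+ 2
             + N%:R * \tr K * t * zeta / (4 * delta ^+ 3)) * (t * zeta)] >]).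
  by congr measurable; apply/seteqP; split=> w /asboolP.
(* On the Markov event the deterministic bound applies with [tau = t * zeta]. *)
move=> w /= trlt; have [psdKt psdD] := res (draws s r w).
have deltaE : delta = dmin K - sqrtN * (t * zeta) by rewrite /delta mulrA.
have := normalize_diff_lt N_gt0 psdK psdKt psdD _ trlt.
by rewrite -/sqrtN -deltaE mulrA => /(_ delta_gt0) [].
Qed.
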